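(* Let $V$ be a countable (finite or countably infinite) set. For every $n\in\mathbb{N}$ there exists a natural number $C_2=C_2(n)$, and for every $k\geq C_2$ there exists a natural number $D_{k,n}$, such that for each $k\geq C_2$ the proposition $F\left(V,k,\binom{n}{2}+1\right)$ holds provided $|V|\geq D_{k,n}$.
   Context: For a set $V$ and natural numbers $k,m$, the proposition $F(V,k,m)$ states: for every colouring of the edges of the complete graph on vertex set $V$ using exactly $k$ colours, there is a subset $X\subset V$ such that the edges with both endpoints in $X$ use exactly $m$ distinct colours. *)

(* Defs.v *)
From mathcomp Require Export all_boot.
From mathcomp Require Export boolp classical_sets functions cardinality.

Set Implicit Arguments.
Unset Strict Implicit.
Unset Printing Implicit Defensive.

Local Open Scope classical_set_scope.
Local Open Scope card_scope.

Definition edges (V : Type) (X : set V) : set (set V) :=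
  [set e | e `<=` X /\ e #= `I_2].

(* An edge colouring is given as a function [c : set V -> nat], of which only
   the values on the two-element subsets of [V] matter.  Since the number of
   colours used is finite, there is no loss in taking colours in [nat]. *)
Definition uses_exactly (V : Type) (c : set V -> nat) (X : set V) (m : nat) :
    Prop :=
  c @` edges X #= `I_m.

Definition F (V : Type) (k m : nat) : Prop :=
  forall c : set V -> nat,
    uses_exactly c [set: V] k -> exists X : set V, uses_exactly c X m.

(* Main.v *)
Require Import Defs.
From mathcomp Require Import zify.

(* The cases n <= 2 are direct; suppose that m = 'C(n, 2) + 1 is at least 4.

   If some vertex v sees many colours, choose neighbours joined to v by distinct
   colours and pass to a canonically coloured subset of them. When it is
   monochromatic (use v as well), or when its edges are coloured injectively by
   their first or by their last endpoint, every number of colours >= 3 is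
   attained. Otherwise it is a large rainbow clique R. As |V| is huge compared
   with k and |R|, two vertices u, u' outside R have the same colours to R. If u
   is joined in one colour to many vertices of R, then u and n of them span m
   colours; if it is joined to many in distinct colours, then u and n - 1
   vertices of R span a rainbow K_n, and u' adds exactly one colour.

   If every vertex sees few colours, then among k edges of distinct colours
   there is a large matching for which the four kinds of cross edges are each
   monochromatic. Selecting both endpoints of some matching edges and one
   endpoint of four others gives every number of colours >= 4. *)

Set Implicit Arguments.
Unset Strict Implicit.
Unset Printing Implicit Defensive.

(** * Pigeonhole principles *)

Section Pigeonhole.
Variables (T K : eqType).
Implicit Types (f : T -> K) (s : seq T) (L : seq K).

Lemma constant_mapP f s :
  reflect {in s &, forall x y, f x = f y} (constant (map f s)).
Proof.
apply: (iffP idP) => [|eq_f].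
  case: s => //= x s /allP fx.
  suff fE y : y \in x :: s -> f y = f x by move=> y z /fE-> /fE->.
  by rewrite in_cons => /predU1P[->|/(map_f f)/fx/eqP].
case: s eq_f => //= x s eq_f; apply/allP => _ /mapP[y ys ->] /=.
by apply/eqP/eq_f; rewrite !in_cons ?eqxx ?ys ?orbT.
Qed.

Lemma undup_map_subseq f s :
  exists2 t, subseq t s & map f t = undup (map f s).
Proof.
have /subseqP[m _ ->] := undup_subseq (map f s).
by exists (mask m s); rewrite ?mask_subseq ?map_mask.
Qed.

Lemma size_leq_count_undup L a :
  (forall d, count_mem d L <= a) -> size L <= a * size (undup L).
Proof.
move=> le_a; rewrite -(perm_size (perm_count_undup L)) size_flatten /shape.
rewrite -map_comp; elim: (undup L) => //= d M IHM.
by rewrite size_nseq mulnS leq_add.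
Qed.

Lemma pigeonhole_subseq f a b s : a * b < size s ->
  exists2 t, subseq t s &
    (a < size t /\ exists d, {in t, forall x, f x = d}) \/
    (b < size t /\ uniq (map f t)).
Proof.
move=> sz; have [b_lt|le_b] := ltnP b (size (undup (map f s))).
  have [t ts ft] := undup_map_subseq f s; exists t => //; right.
  by rewrite -(size_map f) ft undup_uniq.
have [[d a_lt]|no_d] := pselect (exists d, a < count_mem d (map f s)).
  exists [seq x <- s | f x == d]; first exact: filter_subseq.
  left; rewrite size_filter -(count_map f (pred1 d)); split=> //.
  by exists d => x; rewrite mem_filter => /andP[/eqP].
have /size_leq_count_undup : forall d, count_mem d (map f s) <= a.
  by move=> d; rewrite leqNgt; apply/negP => a_lt; case: no_d; exists d.
by rewrite size_map; nia.
Qed.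

Lemma subseq_avoiding f L s : uniq (map f s) ->
  exists2 t, subseq t s &
    size s <= size L + size t /\ {in t, forall x, f x \notin L}.
Proof.
move=> us; exists [seq x <- s | f x \notin L]; first exact: filter_subseq.
split=> [|x]; last by rewrite mem_filter => /andP[].
rewrite size_filter -(count_predC (fun x => f x \in L) s) leq_add2r.
rewrite -(count_map f (mem L)) -size_filter uniq_leq_size ?filter_uniq // => d.
by rewrite mem_filter => /andP[].
Qed.

End Pigeonhole.

Lemma subseq_all_avoiding (S T K : eqType) (f : S -> T -> K) L r s :
    all (fun y => uniq (map (f y) s)) r ->
  exists2 t, subseq t s & size s <= size r * size L + size t /\
    {in r & t, forall y x, f y x \notin L}.
Proof.
elim: r => [|y r IHr] /=; first by exists s.
case/andP=> uy /IHr[t ts [szt new_t]].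
have [u ut [szu new_u]] := subseq_avoiding L (subseq_uniq (map_subseq _ ts) uy).
exists u; first exact: subseq_trans ut ts.
split=> [|z x]; first by rewrite mulSn; move: szt szu; lia.
rewrite in_cons => /predU1P[->|zr] xu; first exact: new_u.
by rewrite new_t // (mem_subseq ut).
Qed.

Definition image_bounded (T K : eqType) (f : T -> K) (b : nat) : Prop :=
  forall s, uniq (map f s) -> size s <= b.

Lemma image_bounded_fin (T : eqType) (K : finType) (f : T -> K) :
  image_bounded f #|K|.
Proof.
by move=> s; rewrite -(size_map f) => /card_uniqP <-; exact: max_card.
Qed.

Lemma image_bounded_comp (S T K : eqType) (f : T -> K) (h : S -> T) b :
  image_bounded f b -> image_bounded (f \o h) b.
Proof. by move=> fb s; rewrite map_comp -(size_map h); exact: fb. Qed.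

Lemma image_bounded_pair (T K1 K2 : eqType) (f : T -> K1) (g : T -> K2) a b :
  image_bounded f a -> image_bounded g b ->
  image_bounded (fun x => (f x, g x)) (a * b).
Proof.
move=> fa gb s us; rewrite leqNgt mulnC; apply/negP => /(pigeonhole_subseq f).
case=> t ts [[b_lt [d fd]]|[a_lt /fa]]; last by rewrite leqNgt a_lt.
suff /gb : uniq (map g t) by rewrite leqNgt b_lt.
have := subseq_uniq (map_subseq _ ts) us.
suff -> : map (fun x => (f x, g x)) t = map (pair d) (map g t) by move/map_uniq.
by rewrite -map_comp; apply/eq_in_map => x /fd /= ->.
Qed.

(** * The canonical Ramsey theorem *)

Section Forward.
Variables (T K : eqType).
Implicit Types (col : T -> T -> K) (s : seq T).

Fixpoint forward (Q : pred (seq K)) col s : bool :=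
  if s is x :: t then Q (map (col x) t) && forward Q col t else true.

Definition backward (Q : pred (seq K)) col s : bool :=
  forward Q (fun x y => col y x) (rev s).

Lemma forward_cat Q col s t : forward Q col (s ++ t) -> forward Q col t.
Proof. by elim: s => //= x s IHs /andP[_ /IHs]. Qed.

Lemma forward_uniq_subseq col s t :
  subseq s t -> forward uniq col t -> forward uniq col s.
Proof.
elim: t s => [|y t IHt] [|x s] //=; case: eqP => [->|_] st /andP[uy ft].
  by rewrite (subseq_uniq (map_subseq _ st)) //= (IHt _ st ft).
exact: IHt st ft.
Qed.

Lemma backward_uniq_subseq col s t :
  subseq s t -> backward uniq col t -> backward uniq col s.
Proof. by rewrite -subseq_rev; exact: forward_uniq_subseq. Qed.

Lemma forward_uniq_cat col s t :
  forward uniq col (s ++ t) -> all (fun x => uniq (map (col x) t)) s.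
Proof.
elim: s => //= x s IHs /andP[+ /IHs->]; rewrite andbT map_cat cat_uniq.
by case/and3P.
Qed.

Lemma backward_uniq_mid col s x t :
  backward uniq col (s ++ x :: t) -> uniq (map (col^~ x) s).
Proof.
rewrite /backward rev_cat rev_cons cat_rcons => /forward_cat /= /andP[+ _].
by rewrite map_rev rev_uniq.
Qed.

Lemma forward_constant_rcons col s z : forward constant col (rcons s z) ->
  pairwise (fun x y => col x y == col x z) s.
Proof.
elim: s => //= x s IHs /andP[/constant_mapP eq_x /IHs->]; rewrite andbT.
apply/allP => y ys; apply/eqP/eq_x; rewrite mem_rcons in_cons ?eqxx //.
by rewrite ys orbT.
Qed.

Lemma pairwise_rev (r : rel T) s :
  pairwise r (rev s) = pairwise (fun x y => r y x) s.
Proof.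
by elim: s => //= x s IHs; rewrite rev_cons pairwise_rcons all_rev IHs.
Qed.

Lemma backward_uniq_cons col x s :
    backward uniq col s -> pairwise (fun y z => col y z != col x z) s ->
  backward uniq col (x :: s).
Proof.
rewrite /backward rev_cons => fs; rewrite -[s in pairwise _ s]revK pairwise_rev.
elim: (rev s) fs => //= z t IHt /andP[uz /IHt {}IHt] /andP[/allP zt /IHt->].
rewrite map_rcons rcons_uniq uz !andbT; apply/mapP => -[y yt eq_y].
by have := zt y yt; rewrite eq_y eqxx.
Qed.

Lemma backward_constant_cons col z s : backward constant col (z :: s) ->
  pairwise (fun x y => col x y == col z y) s.
Proof.
by rewrite /backward rev_cons => /forward_constant_rcons; rewrite pairwise_rev.
Qed.

Definition forward_bound a b : nat := iter (a + b) (fun N => (N * N).+2) 0.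

Lemma forward_ramsey col a b s : forward_bound a b <= size s ->
  exists2 t, subseq t s &
    (a <= size t /\ forward constant col t) \/
    (b <= size t /\ forward uniq col t).
Proof.
rewrite /forward_bound; move eq_n: (a + b) => n.
elim: n a b s eq_n => [|n IHn] [|a] [|b] s //;
  try by exists [::]; [exact: sub0seq | by [left | right]].
move=> [eq_n]; case: s => //= x s; rewrite ltnS => sz.
have sub t u : subseq t u -> subseq u s -> subseq t (x :: s).
  by move=> tu us; exact: subseq_trans tu (subseq_trans us (subseq_cons s x)).
have [u us [[/ltnW lt_u [d eq_d]]|[/ltnW lt_u uniq_u]]] :=
  pigeonhole_subseq (col x) sz.
- have [|t tu [[a_le ft]|]] := IHn a b.+1 u _ lt_u; first lia.
    exists (x :: t); first by rewrite /= eqxx (subseq_trans tu).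
    left; rewrite /= ft andbT; split=> //; apply/constant_mapP => y z yt zt.
    by rewrite !eq_d ?(mem_subseq tu).
  by exists t; [exact: sub us | right].
- have [|t tu [|[b_le ft]]] := IHn a.+1 b u _ lt_u; first lia.
    by exists t; [exact: sub us | left].
  exists (x :: t); first by rewrite /= eqxx (subseq_trans tu).
  by right; rewrite /= ft (subseq_uniq (map_subseq _ tu)).
Qed.

Lemma backward_ramsey col a b s : forward_bound a b <= size s ->
  exists2 t, subseq t s &
    (a <= size t /\ backward constant col t) \/
    (b <= size t /\ backward uniq col t).
Proof.
rewrite -size_rev => /(forward_ramsey (fun x y => col y x))[t ts t_col].
exists (rev t); first by rewrite -(revK s) subseq_rev.
by rewrite /backward size_rev revK.
Qed.

End Forward.

Section Colours.
Variables (T K : eqType).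
Implicit Types (col : T -> T -> K) (s t : seq T).

Fixpoint colours col s : seq K :=
  if s is x :: t then map (col x) t ++ colours col t else [::].

Definition rainbow col s : bool := uniq (colours col s).

Lemma size_colours col s : size (colours col s) = 'C(size s, 2).
Proof.
by elim: s => //= x s IHs; rewrite size_cat size_map IHs binS bin1 addnC.
Qed.

Lemma all_colours (p : pred K) col s :
  all p (colours col s) = pairwise (fun x y => p (col x y)) s.
Proof. by elim: s => //= x s IHs; rewrite all_cat all_map IHs. Qed.

Lemma mem_colours col s d :
    commutative col -> uniq s -> d \in colours col s <->
  exists x y, [/\ x \in s, y \in s, x != y & col x y = d].
Proof.
move=> colC; elim: s => [|z s IHs] /=; first by split=> // -[x [y []]].
case/andP=> zs /IHs {}IHs; rewrite mem_cat; split.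
  case/orP=> [/mapP[y ys ->]|/IHs[x [y [xs ys xy <-]]]].
    exists z, y; rewrite !in_cons eqxx ys orbT; split=> //.
    by apply: contraNneq zs => ->.
  by exists x, y; rewrite !in_cons xs ys !orbT.
case=> x [y []]; rewrite !in_cons.
case: (eqVneq x z) => [->|xz] /=; case: (eqVneq y z) => [->|yz] //=.
- by move=> _ ys _ <-; rewrite map_f.
- by move=> xs _ _ <-; rewrite colC map_f.
- by move=> xs ys xy E; apply/orP; right; apply/IHs; exists x, y.
Qed.

Lemma colours_subseq col s t :
  subseq s t -> subseq (colours col s) (colours col t).
Proof.
elim: t s => [|y t IHt] [|x s] //=; rewrite ?sub0seq //.
case: eqP => [->|_] st; first by rewrite cat_subseq ?map_subseq ?IHt.
exact: subseq_trans (IHt _ st) (suffix_subseq _ _).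
Qed.

Lemma perm_colours_rcons col s z :
  perm_eq (colours col (rcons s z)) (map (col^~ z) s ++ colours col s).
Proof.
elim: s => //= x s IHs; rewrite map_rcons cat_rcons -cat1s perm_catCA /=.
by rewrite perm_cons (perm_trans (perm_cat (perm_refl _) IHs)) // perm_catCA.
Qed.

Lemma perm_colours_rev col s :
  perm_eq (colours col (rev s)) (colours (fun x y => col y x) s).
Proof.
elim: s => //= x s IHs.
rewrite rev_cons (permPl (perm_colours_rcons _ _ _)) perm_cat //.
by rewrite perm_map // perm_rev.
Qed.

Lemma rainbow_subseq col s t : subseq s t -> rainbow col t -> rainbow col s.
Proof. by move=> st; apply: subseq_uniq; exact: colours_subseq. Qed.

Lemma rainbow_cons col x s : rainbow col (x :: s) =
  [&& uniq (map (col x) s), all [predC map (col x) s] (colours col s)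
    & rainbow col s].
Proof. by rewrite /rainbow /= cat_uniq -all_predC. Qed.

Lemma rainbow_forward col s : rainbow col s -> forward uniq col s.
Proof.
by elim: s => //= x s IHs; rewrite rainbow_cons => /and3P[-> _ /IHs].
Qed.

Lemma rainbow_backward col s : rainbow col s -> backward uniq col s.
Proof.
rewrite /backward => us; apply: rainbow_forward.
by rewrite /rainbow (perm_uniq (perm_colours_rev _ _)).
Qed.

Definition min_coloured col (g : T -> K) s : bool :=
  pairwise (fun x y => col x y == g x) s.

Definition max_coloured col (g : T -> K) s : bool :=
  pairwise (fun x y => col x y == g y) s.

Definition monochromatic col (d : K) s : bool := min_coloured col (fun=> d) s.

(* [col x y] is only consulted for [x] before [y] in [s], so that [col] need
   not be commutative. *)
Variant canonical col s : Prop :=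
  | Monochromatic d of monochromatic col d s
  | MinColoured g of min_coloured col g s & uniq (map g s)
  | MaxColoured g of max_coloured col g s & uniq (map g s)
  | Rainbow of rainbow col s.

Fixpoint rainbow_bound a p : nat :=
  if a is a'.+1 then (rainbow_bound a' p.+1 + p * 'C(p, 2)).+1 else 0.

(* Scanning [s] from the left, drop every vertex that would repeat a colour:
   backward injectivity leaves only repetitions between [col x y] and a colour
   of [r], and forward injectivity bounds their number. *)
Lemma rainbow_extension col a r s : rainbow col r ->
    forward uniq col (r ++ s) -> backward uniq col (r ++ s) ->
    rainbow_bound a (size r) <= size s ->
  exists2 t, subseq t s & a <= size t /\ rainbow col (r ++ t).
Proof.
elim: a r s => [|a IHa] r s rr fs bs sz.
  by exists [::]; rewrite ?sub0seq ?cats0.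
have [[|y s'] good_s [sz_good good_new]] :=
  subseq_all_avoiding (colours col r) (forward_uniq_cat fs).
  by move: sz sz_good; rewrite size_colours /=; lia.
have sub : subseq (rcons r y ++ s') (r ++ s) by rewrite cat_rcons cat_subseq.
have {}fs := forward_uniq_subseq sub fs.
have {}bs := backward_uniq_subseq sub bs.
have ry : rainbow col (rcons r y).
  rewrite /rainbow (perm_uniq (perm_colours_rcons _ _ _)) cat_uniq.
  rewrite -/(rainbow col r) rr (backward_uniq_mid (t := s')) -?cat_rcons //=.
  rewrite andbT has_sym; apply/hasPn => _ /mapP[x xr ->].
  by rewrite good_new ?mem_head.
have [|t ts [a_le rt]] := IHa _ _ ry fs bs.
  by move: sz sz_good; rewrite size_colours size_rcons /=; lia.
exists (y :: t); last by rewrite -cat_rcons.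
by apply: subseq_trans good_s; rewrite /= eqxx.
Qed.

Lemma forward_constant_canonical col a s :
    forward constant col s -> a * a < (size s).-1 ->
  exists2 t, subseq t s & a <= size t /\ canonical col t.
Proof.
case/lastP: s => // s z; rewrite size_rcons => /forward_constant_rcons fs sz.
have [t ts t_col] := pigeonhole_subseq (col^~ z) sz; exists t.
  by rewrite (subseq_trans ts) // -cats1 prefix_subseq.
have {}fs := subseq_pairwise ts fs.
case: t_col => [[/ltnW a_le [d eq_d]]|[/ltnW a_le ut]]; split=> //; last first.
  exact: MinColoured fs ut.
apply: (Monochromatic (d := d)); apply: (sub_in_pairwise _ (allss t) fs).
by move=> x y xt yt; rewrite /= eq_d.
Qed.

Lemma backward_constant_canonical col a s :
    forward uniq col s -> backward constant col s -> a < size s ->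
  exists2 t, subseq t s & a <= size t /\ canonical col t.
Proof.
case: s => //= z s /andP[us _] /backward_constant_cons bs sz.
by exists s; [exact: subseq_cons | split; last exact: MaxColoured bs us].
Qed.

Definition canonical_bound a : nat :=
  forward_bound (a * a).+2 (forward_bound a.+1 (rainbow_bound a 0)).

Theorem canonical_ramsey col a s : canonical_bound a <= size s ->
  exists2 t, subseq t s & a <= size t /\ canonical col t.
Proof.
move/(forward_ramsey col) => [t ts [[sz ft]|[sz ft]]].
  have [|u ut ?] := forward_constant_canonical (a := a) ft; first lia.
  by exists u; first exact: subseq_trans ts.
have [u ut [[u_lt bu]|[u_le bu]]] := backward_ramsey col sz.
  have [v vu ?] :=
    backward_constant_canonical (forward_uniq_subseq ut ft) bu u_lt.
  by exists v; first exact: subseq_trans vu (subseq_trans ut ts).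
have [v vu [v_le rv]] :=
  rainbow_extension (r := [::]) isT (forward_uniq_subseq ut ft) bu u_le.
exists v; first exact: subseq_trans vu (subseq_trans ut ts).
by split; last exact: Rainbow.
Qed.

End Colours.

Lemma ramsey_image_bounded (T K : eqType) (col : T -> T -> K) a b s :
    (forall x, image_bounded (col x) b) ->
    (forall y, image_bounded (col^~ y) b) ->
    canonical_bound (maxn a b.+2) <= size s ->
  exists2 t, subseq t s & a <= size t /\ exists d, monochromatic col d t.
Proof.
move=> boundl boundr /(canonical_ramsey col)[t ts []]; rewrite geq_max.
case/andP=> a_le b_lt t_col; exists t => //; split=> //.
case: t_col => [d td|g|g|]; first by exists d.
- case/lastP: t b_lt {ts a_le} => // t z; rewrite size_rcons ltnS => b_lt.
  rewrite /min_coloured pairwise_rcons map_rcons rcons_uniq.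
  case/andP=> /allP tz _ /andP[_ ut].
  suff /boundr : uniq (map (col^~ z) t) by rewrite leqNgt b_lt.
  by rewrite (eq_in_map _ g _).1 // => x /tz /eqP.
- case: t b_lt {ts a_le} => //= z t; rewrite ltnS => b_lt.
  rewrite /max_coloured /= => /andP[/allP zt _] /andP[_ ut].
  suff /boundl : uniq (map (col z) t) by rewrite leqNgt b_lt.
  by rewrite (eq_in_map _ g _).1 // => x /zt /eqP.
- case: t b_lt {ts a_le} => //= z t; rewrite ltnS => b_lt.
  by rewrite rainbow_cons => /andP[/boundl]; rewrite leqNgt b_lt.
Qed.

Lemma mem_map_const (T K : eqType) (f : T -> K) d s :
  0 < size s -> {in s, forall x, f x = d} -> map f s =i [:: d].
Proof.
case: s => // x s _ eq_d e; rewrite inE; apply/mapP/eqP => [[y /eq_d <-]|->] //.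
by exists x; rewrite ?eq_d ?mem_head.
Qed.

Lemma mem_colours_min_coloured (T K : eqType) (col : T -> T -> K) g s z :
  min_coloured col g (rcons s z) -> colours col (rcons s z) =i map g s.
Proof.
rewrite /min_coloured; elim: s => //= x s IHs /andP[/allP gx /IHs eq_s] d.
rewrite mem_cat eq_s in_cons (mem_map_const (d := g x)) ?inE ?size_rcons //.
by move=> y /gx /eqP.
Qed.

(** * Stars with many colours *)

Definition spans_exactly (T K : eqType) (col : T -> T -> K) (m : nat) : Prop :=
  exists2 s, uniq s & size (undup (colours col s)) = m.

Definition rainbow_star (T K : eqType) (col : T -> T -> K) v s : bool :=
  (v \notin s) && uniq (map (col v) s).

Section Spanning.
Variables (T K : eqType) (col : T -> T -> K).
Hypothesis colC : commutative col.
Implicit Types (s : seq T) (L : seq K) (v : T).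

Lemma spans_of_mem_colours s L :
  uniq s -> uniq L -> colours col s =i L -> spans_exactly col (size L).
Proof.
move=> us uL sL; exists s => //; apply/perm_size/uniq_perm => // [|d].
  exact: undup_uniq.
by rewrite mem_undup sL.
Qed.

Lemma min_coloured_spans g s m :
  min_coloured col g s -> uniq (map g s) -> m < size s -> spans_exactly col m.
Proof.
move=> gs us sz; have ts := take_subseq s m.+1.
have {gs}gt := subseq_pairwise ts gs.
have {us}ut := subseq_uniq (map_subseq g ts) us.
have {ts} := size_takel sz.
case/lastP: (take _ s) => // t z in gt ut *.
rewrite size_rcons => -[<-]; rewrite -(size_map g).
apply: spans_of_mem_colours (map_uniq ut) _ (mem_colours_min_coloured gt).
by move: ut; rewrite map_rcons rcons_uniq => /andP[].
Qed.

Lemma max_coloured_spans g s m :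
  max_coloured col g s -> uniq (map g s) -> m < size s -> spans_exactly col m.
Proof.
move=> gs us sz; apply: (@min_coloured_spans g (rev s));
  rewrite ?size_rev ?map_rev ?rev_uniq //.
rewrite /min_coloured pairwise_rev; apply: sub_pairwise gs => x y.
by rewrite colC.
Qed.

Lemma monochromatic_star_spans d v s m : rainbow_star col v s ->
  monochromatic col d s -> 2 < m -> m <= size s -> spans_exactly col m.
Proof.
case/andP=> vs us ds m_gt sz.
have [t' t's [szt' new]] := subseq_avoiding [:: d] us.
pose t := take m.-1 t'.
have ts : subseq t s by exact: subseq_trans (take_subseq _ _) t's.
have szt : size t = m.-1 by rewrite size_takel //; move: szt' => /=; lia.
have dt : d \notin map (col v) t.
  by apply/mapP => -[x /mem_take/new + dE]; rewrite inE -dE eqxx.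
have {}vs : v \notin t by apply: contra vs; exact: mem_subseq.
have {}ut := subseq_uniq (map_subseq _ ts) us.
have {ds}dst := subseq_pairwise ts ds.
have -> : m = size (d :: map (col v) t) by rewrite /= size_map szt; lia.
apply: (spans_of_mem_colours (s := v :: t)) => [||e].
- by rewrite /= vs (map_uniq ut).
- by rewrite /= dt.
case/lastP: {vs ut dt ts new} t szt dst => [|t z]; first by move=> /=; lia.
rewrite size_rcons => szt /mem_colours_min_coloured eq_t.
rewrite mem_cat eq_t in_cons orbC (mem_map_const (d := d)) ?inE //.
by move: szt; lia.
Qed.

Lemma rainbow_star_spans_or_clique v s (r m : nat) :
    rainbow_star col v s -> 2 < m ->
    canonical_bound (maxn r m.+1) <= size s ->
  spans_exactly col m \/
  exists t, [/\ uniq t, rainbow col t & size t = r].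
Proof.
case/andP=> vs us m_gt /(canonical_ramsey col)[t ts []]; rewrite geq_max.
case/andP=> r_le m_lt t_col.
have {}vs : v \notin t by apply: contra vs; exact: mem_subseq.
have {us}ut := subseq_uniq (map_subseq _ ts) us.
case: t_col => [d dt|g gt ug|g gt ug|rt]; [left|left|left|right].
- apply: (monochromatic_star_spans (v := v)) dt m_gt (ltnW m_lt).
  exact/andP.
- exact: min_coloured_spans gt ug m_lt.
- exact: max_coloured_spans gt ug m_lt.
exists (take r t); rewrite size_takel // (rainbow_subseq (take_subseq _ _) rt).
by rewrite take_uniq ?(map_uniq ut).
Qed.

Lemma rainbow_avoid_colour d x s : rainbow col (x :: s) ->
  exists t, [/\ subseq t s, size s <= (size t).+1
                & d \notin colours col (x :: t)].
Proof.
elim: s x => [|y s IHs] x rs; first by exists [::].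
have [ds|nds] := boolP (d \in colours col (y :: s)).
  move: rs; rewrite rainbow_cons => /and3P[_ /allP/(_ d ds) /= dx].
  case/IHs=> t [ts sz dt].
  have yts : subseq (y :: t) (y :: s) by rewrite /= eqxx.
  exists (y :: t); split=> //.
  rewrite [colours _ _]/= mem_cat negb_or dt andbT.
  by apply: contra dx; exact: (mem_subseq (map_subseq _ yts)).
have uxs : uniq (map (col x) (y :: s)).
  by move: rs; rewrite rainbow_cons => /and3P[].
have [t ts [szt new]] := subseq_avoiding [:: d] uxs.
exists t; split=> //; rewrite /= mem_cat negb_or; apply/andP; split.
  by apply/mapP => -[z /new + dE]; rewrite inE -dE eqxx.
by apply: contra nds; exact: (mem_subseq (colours_subseq col ts)).
Qed.

End Spanning.

(** * Twins over a rainbow clique *)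

Definition injective_apex_bound a : nat :=
  canonical_bound (maxn (maxn 3 (rainbow_bound a 1)) #|{: bool}|.+2).

Lemma rainbow_injective_apex (T K : eqType) (col : T -> T -> K) a u r :
    rainbow col r -> uniq (map (col u) r) ->
    injective_apex_bound a <= size r ->
  exists2 t, subseq t r & a <= size t /\ rainbow col (u :: t).
Proof.
move=> rr ur sz; pose same x y := col x y == col u y.
have [||t tr []] := ramsey_image_bounded _ _ sz (col := same).
- by move=> x; exact: image_bounded_fin.
- by move=> y; exact: image_bounded_fin.
rewrite geq_max => /andP[t3 szt] [b tb]; have rt := rainbow_subseq tr rr.
have {tb} different : pairwise (fun x y => col x y != col u y) t.
  case: b tb; last by apply: sub_pairwise => x y /eqP/negbT.
  case: t t3 rt {szt tr} => [|x [|y [|z t]]] // _ rt.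
  case/and3P=> /and3P[_ /eqP/eqP xz _] /andP[/eqP/eqP yz _] _.
  move: rt; rewrite rainbow_cons => /and3P[_ /allP/(_ (col y z))].
  by rewrite /= xz yz !inE eqxx orbT => /(_ isT).
have ut := subseq_uniq (map_subseq _ tr) ur.
have [||v vt ?] := @rainbow_extension _ _ col a [:: u] t isT _ _ szt.
- by rewrite /= ut rainbow_forward.
- by apply: backward_uniq_cons different; exact: rainbow_backward.
- by exists v; first exact: subseq_trans tr.
Qed.

Section Apex.
Variables (T K : eqType) (col : T -> T -> K).
Hypothesis colC : commutative col.
Implicit Types (r s t : seq T) (u : T).

Lemma constant_apex_spans d u s n : rainbow col s -> uniq (u :: s) ->
    {in s, forall x, col u x = d} -> 0 < n < size s ->
  spans_exactly col ('C(n, 2) + 1).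
Proof.
case: s => [|x s] rs us eq_d /andP[n_gt szs] //.
have [t [ts szt dt]] := rainbow_avoid_colour d rs.
pose w := take n (x :: t).
have wt : subseq w (x :: t) by exact: take_subseq.
have ws : subseq w (x :: s) by apply: subseq_trans wt _; rewrite /= eqxx.
have szw : size w = n by rewrite size_takel //= (leq_trans _ szt).
have -> : 'C(n, 2) + 1 = size (d :: colours col w).
  by rewrite /= size_colours szw addn1.
apply: (spans_of_mem_colours (s := u :: w)).
- by apply: subseq_uniq us; rewrite /= eqxx.
- rewrite /= -/(rainbow col w) (rainbow_subseq ws) // andbT; apply: contra dt.
  exact: (mem_subseq (colours_subseq col wt)).
- move=> e; rewrite mem_cat (mem_map_const (d := d)) ?inE ?szw // => y.
  by move/(mem_subseq ws)/eq_d.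
Qed.

Lemma twin_apex_spans u u' t : uniq [:: u', u & t] -> rainbow col (u :: t) ->
    {in t, forall x, col u x = col u' x} ->
    col u u' \notin colours col (u :: t) ->
  spans_exactly col ('C((size t).+1, 2) + 1).
Proof.
move=> us rt twin dt.
rewrite -[_.+1]/(size (u :: t)) -(size_colours col) addn1.
rewrite -[_.+1]/(size (col u u' :: colours col (u :: t))).
apply: (spans_of_mem_colours us) => [|e]; first by rewrite cons_uniq dt.
rewrite /= !in_cons !mem_cat (colC u').
have -> : map (col u') t = map (col u) t by apply/eq_in_map => x /twin.
by congr (_ || _); rewrite orbA orbb.
Qed.

Definition twin_clique_bound n : nat := (n * injective_apex_bound n).+1.

Lemma rainbow_twins_spans r u u' n : rainbow col r -> uniq [:: u', u & r] ->
    {in r, forall x, col u x = col u' x} -> 0 < n ->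
    twin_clique_bound n <= size r ->
  spans_exactly col ('C(n, 2) + 1).
Proof.
move=> rr ur twin n_gt /(pigeonhole_subseq (col u)).
case=> s sr [[szs [d eq_d]]|[/ltnW szs us]].
  apply: (constant_apex_spans (rainbow_subseq sr rr) _ eq_d); last exact/andP.
  have uur : uniq (u :: r) by case/andP: ur.
  by apply: subseq_uniq uur; rewrite /= eqxx.
have [t ts [szt rt]] := rainbow_injective_apex (rainbow_subseq sr rr) us szs.
have [w [wt szw dw]] := rainbow_avoid_colour (col u u') rt.
have vw : subseq (take n.-1 w) w by exact: take_subseq.
have vr : subseq (take n.-1 w) r.
  exact: subseq_trans vw (subseq_trans wt (subseq_trans ts sr)).
have -> : n = (size (take n.-1 w)).+1 by rewrite size_takel //; lia.
apply: (@twin_apex_spans u u').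
- by apply: subseq_uniq ur; rewrite /= !eqxx.
- apply: rainbow_subseq rt; rewrite /= eqxx; exact: subseq_trans vw wt.
- by move=> x /(mem_subseq vr)/twin.
- apply: contra dw; apply: (mem_subseq (colours_subseq col _)).
  by rewrite /= eqxx.
Qed.

End Apex.

Lemma constant_rows (S T K : eqType) (f : S -> T -> K) r s L a :
    {in r & s, forall x y, f x y \in L} -> a * size L ^ size r < size s ->
  exists2 t, subseq t s &
    a < size t /\ {in r & t &, forall x y z, f x y = f x z}.
Proof.
elim: r a s => [|x r IHr] a s fL; first by rewrite muln1 => sz; exists s.
rewrite /= expnS (mulnC (size L)) mulnA => sz.
have [t ts [[szt [d eq_d]]|[szt ut]]] := pigeonhole_subseq (f x) sz; last first.
  have : size (map (f x) t) <= size L.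
    apply: uniq_leq_size => // _ /mapP[y /(mem_subseq ts) ys ->].
    by rewrite fL ?mem_head.
  by rewrite size_map leqNgt szt.
have [|u ut [szu eq_u]] := IHr a t _ szt.
  by move=> y z yr /(mem_subseq ts); apply: fL; rewrite in_cons yr orbT.
exists u; first exact: subseq_trans ts.
split=> // y z z'; rewrite in_cons => /predU1P[->|yr] zu z'u; last exact: eq_u.
by rewrite !eq_d ?(mem_subseq ut).
Qed.

Definition palette (T K : eqType) (col : T -> T -> K) (L : seq K) : Prop :=
  uniq L /\ forall d, d \in L <-> exists x y, x != y /\ col x y = d.

Definition twin_bound r k : nat := (k ^ r + r).+1.

Lemma twins_exist (T K : eqType) (col : T -> T -> K)
    (L : seq K) (r vs : seq T) :
    commutative col -> palette col L -> uniq vs ->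
    twin_bound (size r) (size L) <= size vs ->
  exists u u', [/\ u \notin r, u' \notin r, u' != u
                 & {in r, forall x, col u x = col u' x}].
Proof.
move=> colC [_ memL] uvs szvs.
have [|s svs [szs sr]] := @subseq_avoiding _ _ id r vs; first by rewrite map_id.
have us := subseq_uniq svs uvs.
have sz : 1 * size L ^ size r < size s.
  by move: szvs szs; rewrite /twin_bound; lia.
have [|t ts [t_gt eq_t]] := constant_rows (f := col) _ sz.
  move=> x v xr /sr vr; apply/memL; exists x, v; split=> //.
  by apply: contraNneq vr => <-.
case: t => [|u [|u' t]] // in ts t_gt eq_t.
have tr v : v \in [:: u, u' & t] -> v \notin r by move/(mem_subseq ts)/sr.
exists u, u'; split; rewrite ?tr ?inE ?eqxx ?orbT //.
  by have /= := subseq_uniq ts us; rewrite inE negb_or eq_sym => /andP[/andP[]].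
by move=> x xr; rewrite !(colC _ x); apply: eq_t; rewrite ?inE ?eqxx ?orbT.
Qed.

(** * Matchings *)

Section Matching.
Variables (T K : eqType) (col : T -> T -> K).
Hypothesis colC : commutative col.
Implicit Types (s : seq T) (p q : T * T) (ps qs : seq (T * T)) (L : seq K).

Definition partial_col x y : option K :=
  if x == y then None else Some (col x y).

Lemma partial_col_Some x y d :
  partial_col x y = Some d -> x != y /\ col x y = d.
Proof. by rewrite /partial_col; case: eqP => // _ []. Qed.

Definition star_bounded N : Prop :=
  forall v s, rainbow_star col v s -> size s <= N.

Lemma partial_col_bounded N v :
  star_bounded N -> image_bounded (partial_col v) N.+1.
Proof.
move=> bound s us.
have [|t ts [szs vt]] := @subseq_avoiding _ _ id [:: v] s.
  by rewrite map_id (map_uniq us).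
rewrite (leq_trans szs) // ltnS; apply: (bound v); apply/andP; split.
  by apply/negP => /vt; rewrite inE eqxx.
apply: (map_uniq (f := Some)).
rewrite -map_comp (eq_in_map _ (partial_col v) _).1 => [|x /vt].
  exact: subseq_uniq (map_subseq _ ts) us.
by rewrite inE /partial_col eq_sym => /negPf->.
Qed.

(* The value [None] records a coincidence of endpoints, so that a constant value
   of [cross] without [None] forces the edges to form a matching. *)
Definition cross p q :=
  ((partial_col p.1 q.1, partial_col p.1 q.2),
   (partial_col p.2 q.1, partial_col p.2 q.2)).

Lemma cross_boundedl N :
  star_bounded N -> forall p, image_bounded (cross p) (N.+1 ^ 4).
Proof.
move=> bound p; rewrite (expnD _ 2 2) -mulnn.
have bound_end v (h : T * T -> T) :
    image_bounded (fun q => partial_col v (h q)) N.+1.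
  apply: (image_bounded_comp (f := partial_col v)).
  exact: partial_col_bounded.
by do 2!apply: image_bounded_pair; apply: bound_end.
Qed.

Lemma cross_boundedr N :
  star_bounded N -> forall q, image_bounded (cross^~ q) (N.+1 ^ 4).
Proof.
move=> bound q; rewrite (expnD _ 2 2) -mulnn.
have bound_end v (h : T * T -> T) :
    image_bounded (fun p => partial_col (h p) v) N.+1.
  have : image_bounded (partial_col v \o h) N.+1.
    by apply: image_bounded_comp; exact: partial_col_bounded.
  congr image_bounded; apply/funext => p.
  by rewrite /= /partial_col eq_sym colC.
by do 2!apply: image_bounded_pair; apply: bound_end.
Qed.

Definition edge_col p : K := col p.1 p.2.

Definition rainbow_edges ps : bool :=
  all (fun p => p.1 != p.2) ps && uniq (map edge_col ps).

Lemma rainbow_edges_subseq ps qs :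
  subseq ps qs -> rainbow_edges qs -> rainbow_edges ps.
Proof.
move=> sub /andP[neq uqs]; rewrite /rainbow_edges.
rewrite (subseq_uniq (map_subseq _ sub) uqs) andbT.
by apply/allP => p /(mem_subseq sub); exact: (allP neq).
Qed.

Lemma common_end_bounded N v ps : star_bounded N -> rainbow_edges ps ->
  {in ps, forall p, v \in [:: p.1; p.2]} -> size ps <= N.
Proof.
move=> bound /andP[/allP neq ups] vps.
pose other p := if v == p.1 then p.2 else p.1.
rewrite -(size_map other); apply: (bound v); apply/andP; split.
  apply/mapP => -[p pp]; rewrite /other.
  case: (eqVneq v p.1) => [-> eq_p|/eqP //].
  by have := neq p pp; rewrite -eq_p eqxx.
rewrite -map_comp (eq_in_map _ edge_col _).1 // => p pp /=.
have := vps p pp; rewrite /other /edge_col !inE.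
by case: eqP => /= [->|_ /eqP->] //; rewrite colC.
Qed.

Definition homogeneous a b c d ps : bool :=
  monochromatic cross ((Some a, Some b), (Some c, Some d)) ps.

Lemma homogeneous_of_monochromatic N t ps : star_bounded N ->
    rainbow_edges ps -> N.+1 < size ps -> monochromatic cross t ps ->
  exists a b c d, homogeneous a b c d ps.
Proof.
move=> bound; case: ps => // p ps rps N_lt tps.
have {}rps := rainbow_edges_subseq (subseq_cons ps p) rps.
have is_Some x (h : T * T -> T) u : (forall q, h q \in [:: q.1; q.2]) ->
    {in ps, forall q, partial_col x (h q) = u} -> exists a, u = Some a.
  case: u => [a|] h_end x_u; first by exists a.
  suff /(common_end_bounded bound rps) :
      {in ps, forall q, x \in [:: q.1; q.2]} by rewrite leqNgt -ltnS N_lt.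
  move=> q /x_u; rewrite /partial_col; case: eqP => // -> _; exact: h_end.
have fst_end q : q.1 \in [:: q.1; q.2] by rewrite !inE eqxx.
have snd_end q : q.2 \in [:: q.1; q.2] by rewrite !inE eqxx orbT.
case: t => [[a b] [c d]] in tps *; have /andP[/allP pt _] := tps.
have [a' eq_a] : exists a', a = Some a'.
  by apply: (is_Some p.1 fst) => // q /pt /eqP[].
have [b' eq_b] : exists b', b = Some b'.
  by apply: (is_Some p.1 snd) => // q /pt /eqP[].
have [c' eq_c] : exists c', c = Some c'.
  by apply: (is_Some p.2 fst) => // q /pt /eqP[].
have [d' eq_d] : exists d', d = Some d'.
  by apply: (is_Some p.2 snd) => // q /pt /eqP[].
by exists a', b', c', d'; rewrite /homogeneous -eq_a -eq_b -eq_c -eq_d.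
Qed.

Definition ends ps : seq T := flatten [seq [:: p.1; p.2] | p <- ps].

Lemma edge_cols_subset_ends ps :
  {subset map edge_col ps <= colours col (ends ps)}.
Proof.
apply: mem_subseq; elim: ps => //= p ps IHps.
rewrite [edge_col p]/edge_col eqxx.
apply: subseq_trans IHps (subseq_trans _ (suffix_subseq _ _)).
exact: suffix_subseq.
Qed.

Definition coloured_in L x y : bool := (x != y) && (col x y \in L).

Lemma pairwise_coloured_in L s :
  pairwise (coloured_in L) s = uniq s && all [in L] (colours col s).
Proof. by rewrite uniq_pairwise all_colours -pairwise_relI. Qed.

Section Homogeneous.
Variables (a b c d : K) (L : seq K).
Hypothesis sub_L : {subset [:: a; b; c; d] <= L}.

Lemma cross_coloured_in p q :
    cross p q = ((Some a, Some b), (Some c, Some d)) ->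
  {in [:: p.1; p.2] & [:: q.1; q.2], forall x y, coloured_in L x y}.
Proof.
case=> /partial_col_Some[pq11 eq_a] /partial_col_Some[pq12 eq_b].
move=> /partial_col_Some[pq21 eq_c] /partial_col_Some[pq22 eq_d] x y.
rewrite /coloured_in !inE => /orP[]/eqP-> /orP[]/eqP->;
  by rewrite ?eq_a ?eq_b ?eq_c ?eq_d sub_L ?inE ?eqxx ?orbT ?andbT.
Qed.

Lemma cross_coloured_in_ends p ps x : x \in [:: p.1; p.2] ->
    {in ps, forall q, cross p q == ((Some a, Some b), (Some c, Some d))} ->
  all (coloured_in L x) (ends ps).
Proof.
move=> px pps; apply/allP => y /flattenP[_ /mapP[q qps ->] qy].
exact: cross_coloured_in (eqP (pps q qps)) _ _ px qy.
Qed.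

Lemma homogeneous_coloured_in_ends ps : homogeneous a b c d ps ->
    rainbow_edges ps -> {subset map edge_col ps <= L} ->
  pairwise (coloured_in L) (ends ps).
Proof.
elim: ps => //= p ps IHps /andP[/allP pps hps] rps Lps; rewrite -/(ends ps).
rewrite !(cross_coloured_in_ends _ pps) ?inE ?eqxx ?orbT // IHps //.
- have /andP[/andP[neq _] _] := rps.
  by rewrite andbT /coloured_in neq Lps ?mem_head.
- exact: rainbow_edges_subseq (subseq_cons _ p) rps.
- by move=> e eps; rewrite Lps // in_cons eps orbT.
Qed.

Lemma homogeneous_select p ps x s :
    homogeneous a b c d (p :: ps) -> x \in [:: p.1; p.2] ->
    {subset s <= ends ps} /\ pairwise (coloured_in L) s ->
  {subset x :: s <= ends (p :: ps)} /\ pairwise (coloured_in L) (x :: s).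
Proof.
case/andP=> /allP pps _ px [s_ps pw_s]; split.
  move=> y; rewrite in_cons => /predU1P[->|/s_ps yps].
    by rewrite (mem_cat _ [:: p.1; p.2]) px.
  by rewrite (mem_cat _ [:: p.1; p.2]) yps orbT.
rewrite pairwise_cons pw_s andbT; apply/allP => y /s_ps.
exact: (allP (cross_coloured_in_ends px pps)).
Qed.

End Homogeneous.

Lemma cross_colours_subset a b c d p1 p2 p3 p4 ps s :
    homogeneous a b c d [:: p1, p2, p3, p4 & ps] ->
  {subset [:: a; b; c; d] <= colours col [:: p1.1, p2.2, p3.2, p4.1 & s]}.
Proof.
case/andP=> /allP cross1 /andP[/allP cross2 _] e.
have p4_after_p1 : p4 \in [:: p2, p3, p4 & ps] by rewrite !inE eqxx !orbT.
have p4_after_p2 : p4 \in [:: p3, p4 & ps] by rewrite !inE eqxx !orbT.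
have /eqP[/partial_col_Some[_ eq_a] _ _ _] := cross1 p4 p4_after_p1.
have /eqP[_ /partial_col_Some[_ eq_b] _ _] := cross1 p2 (mem_head _ _).
have /eqP[_ _ /partial_col_Some[_ eq_c] _] := cross2 p4 p4_after_p2.
have /eqP[_ _ _ /partial_col_Some[_ eq_d]] := cross2 p3 (mem_head _ _).
rewrite /= eq_a eq_b eq_c eq_d !(inE, mem_cat).
by case/or4P=> ->; rewrite ?orbT.
Qed.

(* One endpoint of each of [p1], ..., [p4] is kept because [ps] alone may be too
   short to show all four cross colours. *)
Lemma homogeneous_spans a b c d p1 p2 p3 p4 ps :
    homogeneous a b c d [:: p1, p2, p3, p4 & ps] -> rainbow_edges ps ->
    all [predC [:: a; b; c; d]] (map edge_col ps) ->
  spans_exactly col (size (undup [:: a; b; c; d]) + size ps).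
Proof.
move=> hom rps; set cs := [:: a; b; c; d] => new.
have /andP[_ hom2] := hom; have /andP[_ hom3] := hom2.
have /andP[_ hom4] := hom3; have /andP[_ hom_ps] := hom4.
pose L := undup cs ++ map edge_col ps.
have cs_L : {subset cs <= L} by move=> e e_cs; rewrite mem_cat mem_undup e_cs.
pose s := [:: p1.1, p2.2, p3.2, p4.1 & ends ps].
have [_] : {subset s <= ends [:: p1, p2, p3, p4 & ps]} /\
    pairwise (coloured_in L) s.
  do 4![apply: (homogeneous_select cs_L) => //;
        first by rewrite !inE eqxx ?orbT].
  split=> //; apply: (homogeneous_coloured_in_ends cs_L) => // e e_ps.
  by rewrite mem_cat e_ps orbT.
rewrite pairwise_coloured_in => /andP[us /allP s_L].
rewrite -(size_map edge_col) -size_cat.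
apply: (spans_of_mem_colours us) => [|e].
  rewrite cat_uniq undup_uniq (eq_has (mem_undup cs)) -all_predC new /=.
  by case/andP: rps.
apply/idP/idP => [/s_L //|].
rewrite mem_cat mem_undup => /orP[|/edge_cols_subset_ends e_ps].
  exact: cross_colours_subset hom e.
by rewrite /= !(in_cons, mem_cat) e_ps !orbT.
Qed.

Definition matching_bound m N : nat :=
  canonical_bound (maxn (m + N + 8) (N.+1 ^ 4).+2).

Lemma rainbow_edges_spans m N ps : 3 < m -> star_bounded N ->
    rainbow_edges ps -> matching_bound m N <= size ps -> spans_exactly col m.
Proof.
move=> m_gt bound rps.
case/(ramsey_image_bounded (cross_boundedl bound) (cross_boundedr bound)).
move=> qs qs_ps [szqs [t tqs]].
have {rps}rqs := rainbow_edges_subseq qs_ps rps.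
have [|a [b [c [d hom]]]] := homogeneous_of_monochromatic bound rqs _ tqs.
  by rewrite (leq_trans _ szqs) //; lia.
case: qs {tqs qs_ps} szqs rqs hom => [|p1 [|p2 [|p3 [|p4 qs]]]] szqs rqs hom;
  try by move: szqs => /=; lia.
set cs := [:: a; b; c; d].
have szcs : size (undup cs) <= 4 by exact: size_undup.
have {}rqs : rainbow_edges qs.
  by apply: rainbow_edges_subseq rqs; exact: (suffix_subseq [:: _; _; _; _]).
have [new new_qs [sz_new notin_cs]] := subseq_avoiding cs (andP rqs).2.
pose s := take (m - size (undup cs)) new.
have s_qs : subseq s qs by exact: subseq_trans (take_subseq _ _) new_qs.
have m_le : m <= size new by move: szqs sz_new => /=; lia.
have -> : m = size (undup cs) + size s by rewrite size_takel; lia.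
apply: homogeneous_spans.
- apply: subseq_pairwise hom.
  exact: (cat_subseq (subseq_refl [:: p1; p2; p3; p4]) s_qs).
- exact: rainbow_edges_subseq s_qs rqs.
- by apply/allP => _ /mapP[q /mem_take/notin_cs + ->].
Qed.

End Matching.

(** * Colourings with many colours *)

Section Palette.
Variables (T K : eqType) (col : T -> T -> K).
Hypothesis colC : commutative col.
Implicit Types (vs : seq T) (L : seq K).

Lemma palette_edges L : palette col L ->
  exists2 ps, rainbow_edges col ps & map (edge_col col) ps = L.
Proof.
case=> uL memL; suff [ps neq psL] : exists2 ps, all (fun p => p.1 != p.2) ps
    & map (edge_col col) ps = L.
  by exists ps => //; rewrite /rainbow_edges neq psL.
have : {in L, forall d, exists x y, x != y /\ col x y = d} by move=> d /memL.
elim: L {uL memL} => [|d L IHL] edgeL; first by exists [::].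
have [x [y [xy eq_d]]] := edgeL d (mem_head _ _).
case: IHL => [e eL|ps neq psL]; first by apply: edgeL; rewrite in_cons eL orbT.
by exists ((x, y) :: ps); rewrite /= ?xy // psL /edge_col eq_d.
Qed.

Lemma one_colour_spans L : palette col L -> 0 < size L -> spans_exactly col 1.
Proof.
case/palette_edges => -[|[x y] ps] /andP[neq _] <- //= _.
by exists [:: x; y] => //; case/andP: neq => xy _; rewrite /= inE xy.
Qed.

Lemma two_coloured_triangle_spans x y z : uniq [:: x; y; z] ->
  col x z = col y z -> col x y != col y z -> spans_exactly col 2.
Proof.
move=> us xz xy; apply: (spans_of_mem_colours (L := [:: col x y; col y z]) us).
  by rewrite /= inE xy.
by move=> d; rewrite /= xz !inE orbb.
Qed.

(* Twins [u, u'] over the ends of two edges of distinct colours: unless some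
   triangle [u, u', x] has two colours, both ends of either edge are joined to
   [u] in the colour of [u, u']. *)
Lemma two_colours_spans L vs : palette col L -> 1 < size L -> uniq vs ->
  twin_bound 4 (size L) <= size vs -> spans_exactly col 2.
Proof.
move=> palL L_gt uvs szvs.
have [[|p [|q ps]] rps psL] := palette_edges palL; try by rewrite -psL in L_gt.
have /andP[/and3P[p_neq q_neq _] ups] := rps.
have pq : edge_col col p != edge_col col q.
  by move: ups; rewrite /= in_cons negb_or => /andP[/andP[]].
have [u [u' [u_r u'_r u'u twin]]] :=
  twins_exist (r := [:: p.1; p.2; q.1; q.2]) colC palL uvs szvs.
set r := [:: _; _; _; _] in u_r u'_r twin.
have r_neq x : x \in r -> (u != x) && (u' != x).
  by move=> xr; apply/andP; split;
    [move: u_r | move: u'_r]; apply: contraNneq => ->.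
have [/allP to_u|/allPn[x xr ux]] :=
  boolP (all (fun x => col u x == col u u') r); last first.
  have /andP[neq neq'] := r_neq x xr.
  apply: (@two_coloured_triangle_spans u u' x); rewrite -?twin 1?eq_sym //.
  by rewrite /= !inE negb_or eq_sym u'u neq neq'.
have spans_edge x y : x \in r -> y \in r -> x != y -> col x y != col u u' ->
    spans_exactly col 2.
  move=> xr yr xy xy_neq; have [/eqP ux /eqP uy] := (to_u x xr, to_u y yr).
  have [/andP[neqx _] /andP[neqy _]] := (r_neq x xr, r_neq y yr).
  apply: (@two_coloured_triangle_spans x y u); rewrite ?(colC _ u) ?ux ?uy //.
  by rewrite /= !inE negb_or xy eq_sym neqx eq_sym neqy.
have [p_u|] := eqVneq (edge_col col p) (col u u').
  by apply: (spans_edge q.1 q.2); rewrite ?inE ?eqxx ?orbT // eq_sym -p_u.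
by apply: (spans_edge p.1 p.2); rewrite ?inE ?eqxx ?orbT.
Qed.

Definition star_size n : nat :=
  canonical_bound (maxn (twin_clique_bound n) ('C(n, 2) + 1).+1).

Lemma many_colours_spans n L vs : palette col L -> 2 < n ->
    matching_bound ('C(n, 2) + 1) (star_size n) <= size L -> uniq vs ->
    twin_bound (twin_clique_bound n) (size L) <= size vs ->
  spans_exactly col ('C(n, 2) + 1).
Proof.
move=> palL n_gt L_ge uvs szvs.
have m_gt : 3 < 'C(n, 2) + 1 by rewrite addn1 ltnS -[3]/('C(3, 2)) leq_bin2l.
have [ps rps psL] := palette_edges palL.
rewrite -psL size_map in L_ge.
have [bound|] := pselect (star_bounded col (star_size n)).
  by apply: (rainbow_edges_spans colC m_gt bound rps).
case/existsNP=> v /existsNP[s /not_implyP[star_s /negP]].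
rewrite -ltnNge => /ltnW.
case/(rainbow_star_spans_or_clique colC star_s (ltnW m_gt)) => //.
case=> r [ur rr szr].
rewrite -szr in szvs.
have [u [u' [u_r u'_r u'u twin]]] := twins_exist colC palL uvs szvs.
apply: (rainbow_twins_spans colC (u := u) (u' := u') rr) => //; last 2 first.
- exact: ltnW (ltnW n_gt).
- by rewrite szr.
by rewrite /= inE negb_or u'u u'_r u_r.
Qed.

End Palette.

(** * Colourings of two-element sets *)

Local Open Scope classical_set_scope.
Local Open Scope card_scope.

Lemma card_seqP (T : eqType) (A : set T) n :
  A #= `I_n <-> exists s, [/\ uniq s, size s = n & A = [set` s]].
Proof.
elim: n A => [|n IHn] A; split.
- rewrite II0 card_eq0 => /eqP->; exists [::]; split=> //.
  by apply/seteqP; split.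
- case=> s [_ /size0nil-> ->]; rewrite II0 card_eq0; apply/eqP/seteqP.
  by split.
- case/eq_cardSP => x Ax /IHn[s [us szs eq_s]].
  have memE y : y \in s <-> A y /\ y <> x.
    by rewrite -[A y /\ _]/((A `\ x) y) eq_s.
  exists (x :: s); rewrite /= us szs andbT; split=> //.
    by apply/negP => /memE[].
  apply/seteqP; split=> y /=; rewrite in_cons.
    by move=> Ay; case: eqVneq => //= /eqP yx; apply/memE.
  by case/predU1P=> [->|/memE[]].
- case=> -[|x s] [] //= /andP[xs us] [szs] ->.
  apply/eq_cardSP; exists x; rewrite /= ?mem_head //.
  apply/IHn; exists s; split=> //; apply/seteqP; split=> y /=.
    by rewrite in_cons => -[/predU1P[->|]].
  by move=> ys; rewrite in_cons ys orbT; split=> // yx; rewrite -yx ys in xs.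
Qed.

Lemma edgesP (V : Type) (X e : set {classic V}) :
  edges X e <-> exists x y, [/\ X x, X y, x != y & e = [set x; y]].
Proof.
have set2E (x y : {classic V}) : [set x; y] = [set` [:: x; y]].
  apply/seteqP; split=> z /=; rewrite !inE.
    by case=> ->; rewrite eqxx ?orbT.
  by case/orP=> /eqP->; [left | right].
split=> [[eX /card_seqP[s [us szs eq_e]]]|[x [y [Xx Xy xy ->]]]]; last first.
  split=> [_ [->|->] //|]; rewrite set2E; apply/card_seqP.
  by exists [:: x; y]; rewrite /= inE xy.
case: s => [|x [|y [|? ?]]] // in us szs eq_e.
exists x, y; rewrite set2E -eq_e; move: us; rewrite /= inE andbT => xy.
by split=> //; apply: eX; rewrite eq_e /= !inE eqxx ?orbT.
Qed.

Definition pair_col (V : Type) (c : set V -> nat) (x y : {classic V}) : nat :=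
  c [set x; y].

Lemma pair_colC (V : Type) (c : set V -> nat) : commutative (pair_col c).
Proof. by move=> x y; rewrite /pair_col setUC. Qed.

Lemma image_edgesP (V : Type) (c : set V -> nat) (X : set {classic V}) d :
  (c @` edges X) d <->
    exists x y, [/\ X x, X y, x != y & pair_col c x y = d].
Proof.
split=> [[e /edgesP[x [y [Xx Xy xy ->]]] <-]|[x [y [Xx Xy xy <-]]]].
  by exists x, y.
by exists [set x; y] => //; apply/edgesP; exists x, y.
Qed.

Lemma uses_exactly_palette (V : Type) (c : set V -> nat) k :
  uses_exactly c [set: V] k ->
  exists2 L, palette (pair_col c) L & size L = k.
Proof.
case/card_seqP => L [uL szL eq_L]; exists L => //; split=> // d.
rewrite -[is_true _]/([set` L] d) -eq_L image_edgesP.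
by split=> -[x [y]]; [case=> _ _ ? ?; exists x, y | case=> ? ?; exists x, y].
Qed.

Lemma spans_uses_exactly (V : Type) (c : set V -> nat) m :
  spans_exactly (pair_col c) m -> exists X : set V, uses_exactly c X m.
Proof.
case=> s us szs; exists [set` s]; apply/card_seqP.
exists (undup (colours (pair_col c) s)); split=> //; first exact: undup_uniq.
apply/predeqP => d; rewrite image_edgesP /= mem_undup.
by rewrite (mem_colours _ (pair_colC c) us).
Qed.

Lemma card_le_uniq_seq (V : Type) D : `I_D #<= [set: V] ->
  exists2 vs : seq {classic V}, uniq vs & size vs = D.
Proof.
case/card_subP => C /(@card_seqP {classic V})[vs [uvs szvs _]] _.
by exists vs.
Qed.

Definition colours_needed n : nat :=
  if n <= 2 then 2 else matching_bound ('C(n, 2) + 1) (star_size n).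

Definition vertices_needed n k : nat :=
  twin_bound (if n <= 2 then 4 else twin_clique_bound n) k.

Lemma palette_spans (T K : eqType) (col : T -> T -> K) n L (vs : seq T) :
    commutative col -> palette col L -> colours_needed n <= size L ->
    uniq vs -> vertices_needed n (size L) <= size vs ->
  spans_exactly col ('C(n, 2) + 1).
Proof.
rewrite /colours_needed /vertices_needed => colC palL.
have [n_le|n_gt] := leqP n 2 => szL uvs szvs.
  case: n => [|[|[|n]]] // in n_le *; last exact: two_colours_spans szvs.
  - exact: one_colour_spans palL (ltnW szL).
  - exact: one_colour_spans palL (ltnW szL).
exact: many_colours_spans szvs.
Qed.

Theorem theorem9 (n : nat) :
  exists C2 : nat, forall k : nat, (C2 <= k)%N ->
  exists D : nat, forall V : Type,
    countable [set: V] -> `I_D #<= [set: V] -> F V k ('C(n, 2) + 1)%N.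
Proof.
exists (colours_needed n) => k k_ge; exists (vertices_needed n k) => V _ V_ge c.
case/uses_exactly_palette => L palL szL; apply: spans_uses_exactly.
have [vs uvs szvs] := card_le_uniq_seq V_ge.
by apply: (palette_spans (pair_colC c) palL _ uvs); rewrite szL ?szvs.
Qed.
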